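(* Let $d\geq 1$ be an integer and let $(k,v)$ be a discretely valued field of characteristic $0$ or greater than $d$, with valuation ring $\mathcal{O}$, value group $\Gamma$ and residue field $\overline{k}$, and assume that $\operatorname{char}\overline{k}\nmid d$. (i) $u_{diag}(d,k)\geq |\Gamma/d\Gamma|\, u_{diag}(d,\overline{k})$. (ii) If moreover $(k,v)$ is Henselian, then $u_{diag}(d,k)= |\Gamma/d\Gamma|\, u_{diag}(d,\overline{k})$. These (in)equalities hold also when the quantities involved are infinite (with the obvious conventions for computing with $\infty$).
   Context: For a field $F$, a diagonal form of degree $d$ and dimension $n$ over $F$ is a polynomial $\langle a_1,\dots,a_n\rangle=a_1x_1^d+\dots+a_nx_n^d$ with all $a_i\in F^\times$. A form (homogeneous polynomial) is anisotropic over $F$ if it has no nontrivial zero in $F^n$, and isotropic otherwise. The diagonal $u$-invariant $u_{diag}(d,F)$ is the supremum (possibly $\infty$) of the dimensions of anisotropic diagonal forms of degree $d$ over $F$. *)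

(* Defs.v *)
From HB Require Import structures.
From mathcomp Require Import all_boot all_order all_algebra.
From mathcomp Require Import generic_quotient ring_quotient.
From mathcomp Require Import boolp classical_sets reals ereal measure.
From mathcomp.multinomials Require mpoly.
Import -(notations) mpoly.

Set Implicit Arguments.
Unset Strict Implicit.
Unset Printing Implicit Defensive.

Import Order.TTheory GRing.Theory Num.Theory.
Local Open Scope classical_set_scope.
Local Open Scope ring_scope.

Section Forms.
Variable F : fieldType.

Definition diag_form (d n : nat) (a : 'I_n -> F) : mpoly n F :=
  \sum_(i < n) a i *: mpolyX F (mnm1 i) ^+ d.

Definition anisotropic (n : nat) (f : mpoly n F) : Prop :=
  forall x : 'I_n -> F, meval x f = 0 -> forall i, x i = 0.

Definition anisotropic_dim (d : nat) : set nat :=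
  [set n | exists2 a : 'I_n -> F,
             forall i, a i != 0 & anisotropic (diag_form d a)].

(* The value is a natural number or +oo; R only serves as a carrier for the
   extended reals, where sup, product and order are taken. *)
Definition u_diag (R : realType) (d : nat) : \bar R :=
  ereal_sup [set n%:R%:E | n in anisotropic_dim d].

End Forms.

(* The library has ordered rings but no ordered abelian groups; porderZmodType
   does not relate the order to the addition. *)
HB.mixin Record isOrderedGroup G of Num.POrderedZmodule G := {
  og_total : forall x y : G, (x <= y) || (y <= x);
  og_leD2r : forall z x y : G, x <= y -> x + z <= y + z
}.

#[short(type="orderedGroupType")]
HB.structure Definition OrderedGroup :=
  { G of isOrderedGroup G & Num.POrderedZmodule G }.

HB.instance Definition _ := isOrderedGroup.Build int (@le_total _ int)
  (fun z x y (lexy : x <= y) => lerD lexy (lexx z)).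

Section MultipleQuotient.
Variables (G : zmodType) (d : nat).

Definition multiples : {pred G} := fun g => `[< exists h, g = h *+ d >].

Fact multiples_zmod_closed : zmod_closed multiples.
Proof.
split; first by apply/asboolP; exists 0; rewrite mul0rn.
move=> x y /asboolP[a ->] /asboolP[b ->].
by apply/asboolP; exists (a - b); rewrite mulrnBl.
Qed.

HB.instance Definition _ :=
  GRing.isZmodClosed.Build G multiples multiples_zmod_closed.

Definition mod_multiples : choiceType := Quotient.quot multiples.

End MultipleQuotient.

Section Valuation.
Variables (k : fieldType) (G : orderedGroupType).

(* v is only meaningful on nonzero elements: "v 0 = oo" is encoded by treating
   0 separately everywhere. G is exactly the value group, by val_surj. *)
Record valuation := Valuation {
  val_fun :> k -> G;
  valM : forall x y, x != 0 -> y != 0 -> val_fun (x * y) = val_fun x + val_fun y;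
  valD : forall x y, x != 0 -> y != 0 -> x + y != 0 ->
    Num.min (val_fun x) (val_fun y) <= val_fun (x + y);
  val_surj : forall g, exists2 x, x != 0 & val_fun x = g
}.

Definition discrete_group : Prop :=
  exists f : int -> G,
    [/\ bijective f, {morph f : x y / x + y} & {mono f : x y / x <= y}].

Variable v : valuation.

Definition valring_pred : {pred k} := fun x => (x == 0) || (0 <= v x).

Fact og_lerD2 (z x y : G) : (x + z <= y + z) = (x <= y).
Proof.
apply/idP/idP; last exact: og_leD2r.
by move=> /(og_leD2r (- z)); rewrite !addrK.
Qed.

Fact val1 : v 1 = 0.
Proof.
have := valM v (oner_neq0 k) (oner_neq0 k).
by rewrite mulr1 -[X in X = _]addr0 => /addrI.
Qed.

Fact valN1 : v (-1) = 0.
Proof.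
have n0 : -1 != 0 :> k by rewrite oppr_eq0 oner_neq0.
have := valM v n0 n0; rewrite mulrNN mulr1 val1.
move=> E; apply/eqP; rewrite eq_le.
case/orP: (og_total (v (-1)) 0) => h; rewrite h ?andbT /=;
  by rewrite -(og_lerD2 (v (-1))) -E add0r.
Qed.

Fact valN x : x != 0 -> v (- x) = v x.
Proof.
by move=> x0; rewrite -mulN1r valM ?oppr_eq0 ?oner_neq0 // valN1 add0r.
Qed.

Fact valV x : x != 0 -> v x^-1 = - v x.
Proof.
move=> x0; apply/(addrI (v x)).
by rewrite -valM ?invr_eq0 // divff // val1 subrr.
Qed.

Fact valringE x : (x \in valring_pred) = (x == 0) || (0 <= v x).
Proof. by []. Qed.

Fact valring_subring_closed : subring_closed valring_pred.
Proof.
split; first by rewrite valringE val1 lexx orbT.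
- move=> x y; rewrite !valringE; have [->|y0] := eqVneq y 0; first by rewrite subr0.
  have [->|x0] /= := eqVneq x 0.
    by move=> _ h; rewrite sub0r valN // h orbT.
  move=> hx hy; have [//|xy0 /=] := eqVneq (x - y) 0.
  have ny0 : - y != 0 by rewrite oppr_eq0.
  apply: le_trans (valD v x0 ny0 xy0).
  by rewrite comparable_le_min ?hx ?valN //; exact: og_total.
- move=> x y; rewrite !valringE; have [->|x0] := eqVneq x 0; first by rewrite mul0r eqxx.
  have [->|y0] := eqVneq y 0; first by rewrite mulr0 eqxx.
  move=> /= hx hy; rewrite valM //; apply/orP; right.
  by apply: le_trans hy _; rewrite -[X in X <= _]add0r og_lerD2.
Qed.

HB.instance Definition _ :=
  GRing.isSubringClosed.Build k valring_pred valring_subring_closed.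

Record valring := Valring { valring_val :> k; _ : valring_val \in valring_pred }.

HB.instance Definition _ := [isSub for valring_val].
HB.instance Definition _ := [Choice of valring by <:].
HB.instance Definition _ := [SubChoice_isSubComNzRing of valring by <:].

Definition maxideal : {pred valring} :=
  fun x => (valring_val x == 0) || (0 < v (valring_val x)).

Fact maxidealE (x : valring) :
  (x \in maxideal) = (valring_val x == 0) || (v (valring_val x) != 0).
Proof.
rewrite /maxideal {1}/in_mem /=; have [//|x0 /=] := eqVneq (valring_val x) 0.
rewrite lt_neqAle eq_sym; case: x x0 => x /= xP x0.
by move: xP; rewrite /valring_pred /in_mem /= (negbTE x0) /= => ->; rewrite andbT.
Qed.

Fact maxideal_idealr_closed : idealr_closed maxideal.
Proof.
split; first by rewrite /maxideal /in_mem /= eqxx.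
- by rewrite maxidealE /= oner_eq0 /= val1 eqxx.
move=> a [x xP] [y yP].
have xO : 0 <= v x \/ x = 0.
  by move: xP => /orP[/eqP|]; [right|left].
case: a => a aP; rewrite /maxideal /in_mem /=.
have [->|a0] := eqVneq a 0; first by rewrite mul0r add0r.
have [->|x0] := eqVneq x 0; first by rewrite mulr0 add0r.
have a_ge0 : 0 <= v a by move: aP => /orP[/eqP/eqP|//]; rewrite (negbTE a0).
move=> /= vx.
have vax : 0 < v (a * x).
  rewrite valM //; apply: lt_le_trans vx _.
  by rewrite -[X in X <= _]add0r og_lerD2.
have [->|y0] := eqVneq y 0; first by rewrite addr0 vax orbT.
move=> /= vy; have [//|s0 /=] := eqVneq (a * x + y) 0.
by apply: lt_le_trans (valD v (mulf_neq0 a0 x0) y0 s0);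
rewrite comparable_lt_min ?vax //; exact: og_total.
Qed.

HB.instance Definition _ :=
  isIdealr.Build valring maxideal maxideal_idealr_closed.

Definition residue := {ideal_quot maxideal}.

HB.instance Definition _ := GRing.ComNzRing.on residue.

Local Open Scope quotient_scope.

Definition residue_map : {rmorphism valring -> residue} := \pi_residue.

Definition residue_inv (q : residue) : residue :=
  if q == 0 then 0 else residue_map (insubd 0 (valring_val (repr q))^-1).

Fact residue_mulVf q : q != 0 -> residue_inv q * q = 1.
Proof.
rewrite /residue_inv => q0; rewrite (negbTE q0).
have E : residue_map (repr q) = q by exact: reprK.
have := q0; rewrite -{1}E => r0.
have : repr q \notin maxideal.
  apply: contra r0 => h.
  by rewrite -(rmorph0 residue_map) -Quotient.idealrBE subr0.
rewrite maxidealE negb_or negbK => /andP[x0 /eqP vx].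
rewrite -{2}E -rmorphM -(rmorph1 residue_map); congr (residue_map _).
apply: val_inj => /=; rewrite insubdK ?mulVf //.
by rewrite /valring_pred /in_mem /= valV // vx oppr0 lexx orbT.
Qed.

Fact residue_inv0 : residue_inv 0 = 0.
Proof. by rewrite /residue_inv eqxx. Qed.

HB.instance Definition _ :=
  GRing.ComNzRing_isField.Build residue residue_mulVf residue_inv0.

Definition henselian : Prop :=
  forall (f : {poly valring}) (alpha : residue), f \is monic ->
    root (map_poly residue_map f) alpha -> ~~ root (map_poly residue_map f)^`() alpha ->
    exists2 a : valring, root f a & residue_map a = alpha.

End Valuation.

(* Main.v *)
(** Let [t] be a uniformizer, so that [|Gamma/d Gamma| = d].

    Lower bound: lift an anisotropic form [f] over the residue field to a form
    [F] with unit coefficients. A nonzero value of [F] has valuation in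
    [d Gamma], since after dividing the arguments by one of minimal valuation
    the value is a unit; hence the nonzero terms among
    [F(x_0), t F(x_1), ..., t^(d-1) F(x_(d-1))] have pairwise distinct
    valuations and cannot cancel, so [F + t F + ... + t^(d-1) F] is anisotropic.

    Upper bound: up to [d]-th powers, the coefficients of an anisotropic form
    over [k] are [t^j u] with [j < d] and [u] a unit. By Hensel's lemma the
    coefficients with a given [j] yield an anisotropic residue form, and the
    largest of these [d] classes has at least [1/d] of the variables. *)

Require Import Defs.
From mathcomp Require Import all_boot all_order all_algebra.
From mathcomp Require Import generic_quotient ring_quotient.
From mathcomp Require Import boolp classical_sets cardinality.
From mathcomp Require Import reals ereal measure ring.
From mathcomp.multinomials Require mpoly.

Set Implicit Arguments.
Unset Strict Implicit.
Unset Printing Implicit Defensive.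

Import Order.TTheory GRing.Theory Num.Theory.
Local Open Scope classical_set_scope.
Local Open Scope ring_scope.

(** * Diagonal forms indexed by finite types *)

Section DiagonalForms.
Context {F : fieldType}.

(** An arbitrary index type with a selected subset [A] lets blocks of a form, and forms indexed by
    pairs, be handled without renumbering the variables. *)
Definition anisotropic_on {I : finType} (d : nat) (A : pred I) (a : I -> F) :=
  forall x : I -> F,
    \sum_(i in A) a i * x i ^+ d = 0 -> forall i, i \in A -> x i = 0.

Lemma meval_diag_form (d n : nat) (a x : 'I_n -> F) :
  mpoly.meval x (diag_form d a) = \sum_(i < n) a i * x i ^+ d.
Proof.
rewrite /diag_form (big_morph _ (mpoly.mevalD x) (mpoly.meval0 x)).
apply: eq_bigr => i _; rewrite mpoly.mevalZ; congr (_ * _).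
elim: d => [|d IH]; first by rewrite !expr0 mpoly.meval1.
by rewrite !exprS mpoly.mevalM mpoly.mevalXU IH.
Qed.

Lemma anisotropic_on_dim (I : finType) (d : nat) (A : pred I) (a : I -> F) :
  {in A, forall i, a i != 0} -> anisotropic_on d A a ->
  anisotropic_dim F d #|A|.
Proof.
move=> a0 anA; exists (a \o enum_val); first by move=> i; exact: a0 (enum_valP i).
move=> y; rewrite meval_diag_form => y0 i.
(* Outside [A] this takes a default value of [y], harmless because the sum runs over [A] only. *)
pose x j := y (enum_rank_in (enum_valP i) j).
have xE j : x (enum_val j) = y j by rewrite /x enum_valK_in.
rewrite -xE; apply: anA (enum_valP i); rewrite big_enum_val -[RHS]y0.
by apply: eq_bigr => j _; rewrite xE.
Qed.

Lemma anisotropic_dimP (d n : nat) :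
  anisotropic_dim F d n -> exists2 a : 'I_n -> F,
    forall i, a i != 0 & anisotropic_on d predT a.
Proof.
case=> a a0 an; exists a => // x x0 i _; apply: (an x).
by rewrite meval_diag_form.
Qed.

End DiagonalForms.

(** * The value group and its quotient modulo [d] *)

Lemma discrete_group_generator (G : orderedGroupType) : discrete_group G ->
  exists g : G, bijective (fun z : int => g *~ z).
Proof.
case=> f [bf fD _]; exists (f 1).
have f0 : f 0 = 0.
  by have := fD 0 0; rewrite addr0 -[X in X = _]addr0 => /addrI.
have fn n : f n%:Z = f 1 *+ n.
  by elim: n => [|n IH]; rewrite ?f0 // mulrS -IH -fD -intS.
apply: (eq_bij bf) => -[n|n]; first exact: fn.
rewrite NegzE mulrNz; apply/eqP; rewrite -addr_eq0 -[X in _ + X]fn -fD.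
by rewrite addNr f0.
Qed.

(** By division with remainder of the integer coordinate, the multiples of [g] by 0, ..., [d] - 1
    represent every class exactly once. *)
Lemma counting_mod_multiples (R : realType) (G : zmodType) (g : G) (d : nat) :
  (0 < d)%N -> bijective (fun z : int => g *~ z) ->
  counting [set: mod_multiples G d] = d%:R%:E :> \bar R.
Proof.
move=> d0 [h hK Kh]; pose f n : mod_multiples G d :=
  (\pi_(Quotient.quot (multiples d)) (g *+ n))%qT.
have f_inj : {in `I_d &, injective f}.
  move=> m n; rewrite !inE /= => md nd /eqP.
  rewrite /f -Quotient.idealrBE => /asboolP[x].
  rewrite -[x]Kh -[g *+ m]/(g *~ m%:Z) -[g *+ n]/(g *~ n%:Z) -mulrzBr.
  rewrite -[_ *+ d]/(_ *~ d%:Z) -mulrzA.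
  move=> /(can_inj hK) /(canRL (subrK _)) mE.
  have := congr1 (modz^~ d%:Z) mE; rewrite /= modzMDl !modz_nat.
  by rewrite !modn_small // => -[].
have fI : f @` `I_d = [set: mod_multiples G d].
  apply/seteqP; split=> // q _; rewrite /image /=.
  pose z := h (repr q); have zE : g *~ z = repr q by rewrite /z Kh.
  have d0' : d%:Z != 0 by rewrite -lt0n.
  have : (0 <= (z %% d)%Z) by rewrite modz_ge0.
  have : (z %% d)%Z < d%:Z by rewrite ltz_pmod.
  case E : (z %% d)%Z => [n|n] // nd _; exists n => //.
  rewrite -[q]reprK; apply/eqP; rewrite -Quotient.idealrBE.
  apply/asboolP; exists (g *~ (- (z %/ d)%Z)).
  rewrite -zE {1}(divz_eq z d) E.
  rewrite -[_ *+ d]/(_ *~ d%:Z) -mulrzA -[g *+ n]/(g *~ n%:Z) -mulrzBr.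
  by congr (_ *~ _); rewrite opprD addrCA subrr addr0 mulNr.
have cT : ([set: mod_multiples G d] #= `I_d)%card.
  by rewrite -fI; exact: inj_card_eq.
have fT : finite_set [set: mod_multiples G d] by apply/finite_setP; exists d.
by rewrite /counting asboolT // (card_fset_set cT).
Qed.

(** * Valuations of powers and sums *)

Section ValuedField.
Context {k : fieldType} {G : orderedGroupType} (v : valuation k G).

Lemma valX (x : k) n : x != 0 -> v (x ^+ n) = v x *+ n.
Proof.
move=> x0; elim: n => [|n IH]; first by rewrite expr0 Defs.val1.
by rewrite exprS Defs.valM ?expf_neq0 // IH mulrS.
Qed.

Lemma valXz (x : k) (z : int) : x != 0 -> v (x ^ z) = v x *~ z.
Proof.
move=> x0; case: z => n; first exact: valX.
by rewrite -[x ^ _]/(x ^- n.+1) Defs.valV ?expf_neq0 // valX.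
Qed.

(** The alternative [s i == 0] stands for infinite valuation; with it, the elements of valuation
    above [g] are closed under addition. *)
Lemma val_sum_gt (I : Type) (r : seq I) (P : pred I) (s : I -> k) (g : G) :
    (forall i, P i -> (s i == 0) || (g < v (s i))) ->
  let S := \sum_(i <- r | P i) s i in (S == 0) || (g < v S).
Proof.
move=> sP /=; apply: (big_ind (fun x => (x == 0) || (g < v x))) => //.
  by rewrite eqxx.
move=> x y; have [->|x0] := eqVneq x 0; first by rewrite add0r.
have [->|y0] := eqVneq y 0; first by rewrite addr0 (negbTE x0).
move=> /= gx gy; have [//|xy0 /=] := eqVneq (x + y) 0.
apply: lt_le_trans (Defs.valD v x0 y0 xy0).
by rewrite comparable_lt_min ?gx //; exact: og_total.
Qed.

Lemma ex_min_val (I : finType) (s : I -> k) i0 : s i0 != 0 ->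
  exists2 j, s j != 0 & forall i, s i != 0 -> v (s j) <= v (s i).
Proof.
move=> si0; pose ord := (fun x y : G => x <= y).
have := @extremumP _ _ ord i0 [pred i | s i != 0] (v \o s) lexx
  (@le_trans _ _) (@og_total G) si0.
by case=> j sj jmin; exists j.
Qed.

(** A nonzero term of minimal valuation would be the opposite of the sum of the others, whose
    valuation is strictly larger. *)
Lemma sum_val_inj (I : finType) (s : I -> k) :
    (forall i j, s i != 0 -> s j != 0 -> v (s i) = v (s j) -> i = j) ->
  \sum_i s i = 0 -> forall i, s i = 0.
Proof.
move=> s_inj s0 i; apply/eqP/negP => /negP /ex_min_val[j sj jmin].
have := @val_sum_gt _ (index_enum I) (predC1 j) s (v (s j)) _.
move: s0; rewrite (bigD1 j) //= addrC => /eqP; rewrite addr_eq0 => /eqP ->.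
rewrite oppr_eq0 (negbTE sj) Defs.valN // ltxx /= => gt.
suff: false by []; apply: gt => l lj.
have [//|sl /=] := eqVneq (s l) 0; rewrite lt_neqAle jmin // andbT.
by apply: contra lj => /eqP /s_inj ->.
Qed.

(** * Reduction to the residue field *)

Lemma residue_map_neq0 (x : valring v) :
  (residue_map v x != 0) = (valring_val x != 0) && (v (valring_val x) == 0).
Proof.
rewrite -[_ && _]negbK negb_and negbK -maxidealE -(rmorph0 (residue_map v)).
by rewrite -[x in x \in _]subr0 Quotient.idealrBE.
Qed.

Lemma residue_map_surj (q : residue v) : exists x : valring v, residue_map v x = q.
Proof. by exists (repr q); exact: reprK. Qed.

Lemma valring_val_form (I : finType) (d : nat) (A : pred I) (a x : I -> valring v) :
  valring_val (\sum_(i in A) a i * x i ^+ d)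
  = \sum_(i in A) valring_val (a i) * valring_val (x i) ^+ d.
Proof.
rewrite -[LHS]/(val _) rmorph_sum; apply: eq_bigr => i _.
by rewrite rmorphM rmorphXn.
Qed.

(* After dividing by an entry of minimal valuation, the value of the form
   becomes an integral element with nonzero residue. *)
Lemma val_lifted_form (I : finType) (d : nat) (a : I -> valring v) (x : I -> k) :
    anisotropic_on d predT (residue_map v \o a) -> (exists i, x i != 0) ->
  let S := \sum_i valring_val (a i) * x i ^+ d in
  S != 0 /\ exists2 y : k, y != 0 & v S = v y *+ d.
Proof.
move=> an [i0 xi0]; have [j xj jmin] := ex_min_val xi0.
have yP i : x i / x j \in valring_pred v.
  rewrite valringE; have [->|xi] := eqVneq (x i) 0; first by rewrite mul0r eqxx.
  rewrite Defs.valM ?invr_eq0 // Defs.valV // -(subrr (v (x j))) og_lerD2.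
  by rewrite jmin ?orbT.
pose y i := Valring (yP i); pose S' := \sum_i a i * y i ^+ d.
have S'0 : residue_map v S' != 0.
  apply/eqP => rS; have : residue_map v (y j) = 0.
    apply: (an (residue_map v \o y)) => //.
    rewrite -[RHS]rS rmorph_sum; apply: eq_bigr => i _.
    by rewrite rmorphM rmorphXn.
  move=> /eqP; apply/negP; rewrite residue_map_neq0 /= divff // oner_neq0 /=.
  by rewrite Defs.val1.
have SE : \sum_i valring_val (a i) * x i ^+ d = valring_val S' * x j ^+ d.
  rewrite (valring_val_form d predT) mulr_suml; apply: eq_bigr => i _.
  by rewrite -mulrA -exprMn divfK.
move: S'0; rewrite residue_map_neq0 => /andP[S'0 /eqP vS'] /=.
rewrite SE mulf_neq0 ?expf_neq0 //; split => //; exists (x j) => //.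
by rewrite Defs.valM ?expf_neq0 // vS' add0r valX.
Qed.

(** * Lower bound: lifting residue forms *)

Lemma anisotropic_dim_lift (d n : nat) (t : k) :
    (0 < d)%N -> t != 0 -> bijective (fun z : int => v t *~ z) ->
  anisotropic_dim (residue v) d n -> anisotropic_dim k d (d * n)%N.
Proof.
move=> d0 t0 [h hK Kh] /anisotropic_dimP[b b0 an].
pose a i := sval (cid (residue_map_surj (b i))).
have aE i : residue_map v (a i) = b i by rewrite /a; case: cid.
have a0 i : valring_val (a i) != 0.
  by have := b0 i; rewrite -aE residue_map_neq0 => /andP[].
have ana : anisotropic_on d predT (residue_map v \o a).
  move=> x xE; apply: an; rewrite -[RHS]xE; apply: eq_bigr => i _.
  by rewrite /= aE.
(* The pair [(j, i)] indexes the [i]-th variable of the [j]-th copy of the lifted form, scaled by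
   [t ^+ j]. *)
pose c (p : 'I_d * 'I_n) := t ^+ p.1 * valring_val (a p.2).
have -> : (d * n)%N = #|(predT : pred ('I_d * 'I_n))|.
  by rewrite -[RHS]/#|{: 'I_d * 'I_n}| card_prod !card_ord.
apply: (@anisotropic_on_dim _ _ _ _ c).
  by move=> p _; rewrite mulf_neq0 ?expf_neq0.
move=> x; pose S j := \sum_i valring_val (a i) * x (j, i) ^+ d.
have -> : \sum_(p in predT) c p * x p ^+ d = \sum_(j < d) t ^+ j * S j.
  under [RHS]eq_bigr do rewrite mulr_sumr.
  by rewrite pair_bigA; apply: eq_bigr => -[j i] _; rewrite /= mulrA.
have x0 j : S j = 0 -> forall i, x (j, i) = 0.
  move=> Sj i; apply/eqP/negP => /negP xji.
  have [/eqP] := @val_lifted_form _ _ _ (fun i => x (j, i)) ana (ex_intro _ i xji).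
  by rewrite -/(S j) Sj.
have vS j : S j != 0 -> exists z : int, v (t ^+ j * S j) = v t *~ (z * d%:Z + j%:Z).
  move=> Sj; have [/existsP ex|] := boolP [exists i, x (j, i) != 0].
    have [_ [y y0 yE]] := @val_lifted_form _ _ _ (fun i => x (j, i)) ana ex.
    exists (h (v y)); rewrite Defs.valM ?expf_neq0 // valX // yE -{1}[v y]Kh.
    by rewrite mulrzDr addrC mulrzA.
  rewrite negb_exists => /forallP xj0; move: Sj; rewrite /S big1 ?eqxx // => i _.
  by have /negPn/eqP-> := xj0 i; rewrite expr0n -[d]prednK // mulr0.
move=> sum0 [j i] _; apply: x0; apply/eqP.
suff /eqP : t ^+ j * S j = 0 by rewrite mulf_eq0 expf_eq0 (negbTE t0) andbF.
apply: (@sum_val_inj _ (fun j : 'I_d => t ^+ j * S j)) sum0 _.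
move=> {}j j'; rewrite !mulf_eq0 !negb_or => /andP[_ /vS[z ->]] /andP[_ /vS[z' ->]].
(* The valuation of a nonzero block, read modulo [d], recovers its index, so distinct blocks cannot
   have equal valuations. *)
move=> /(can_inj hK) /(congr1 (modz^~ d%:Z)) /=; rewrite !modzMDl !modz_nat.
by rewrite !modn_small // => -[] /val_inj.
Qed.

(** * Upper bound: Hensel lifting and splitting into blocks *)

(* Fixing all variables but one nonzero one leaves a polynomial of the shape
   'X^d + c, whose reduction has simple nonzero roots as d is invertible. *)
Lemma henselian_anisotropic_residue (I : finType) (d : nat) (A : pred I)
    (u : I -> valring v) :
    henselian v -> (0 < d)%N -> d%:R != 0 :> residue v ->
    {in A, forall i, residue_map v (u i) != 0} ->
  anisotropic_on d A (fun i => valring_val (u i)) ->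
  anisotropic_on d A (fun i => residue_map v (u i)).
Proof.
move=> hens d0 dn0 u0 an x xE i iA; apply/eqP/negP => /negP xi.
pose X j := sval (cid (residue_map_surj (x j))).
have XE j : residue_map v (X j) = x j by rewrite /X; case: cid.
have [w wu] : exists w, w * u i = 1.
  have := u0 _ iA; rewrite residue_map_neq0 => /andP[ui0 /eqP vui].
  have wP : (valring_val (u i))^-1 \in valring_pred v.
    by rewrite valringE Defs.valV // vui oppr0 lexx orbT.
  by exists (Valring wP); apply: val_inj; rewrite /= mulVf.
pose S := \sum_(j in A | j != i) u j * X j ^+ d.
have rS : residue_map v (u i) * x i ^+ d + residue_map v S = 0.
  rewrite -[RHS]xE (bigD1 i) //=; congr (_ + _); rewrite rmorph_sum.
  by apply: eq_bigr => j _; rewrite rmorphM rmorphXn XE.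
(* Multiplying by the inverse [w] of the unit [u i] makes the equation for the [i]-th variable
   monic. *)
pose f : {poly valring v} := 'X^d + (w * S)%:P.
have fm : f \is monic by rewrite monicXnaddC.
have fE : map_poly (residue_map v) f = 'X^d + (residue_map v (w * S))%:P.
  by rewrite rmorphD /= map_polyXn map_polyC.
have f_root : root (map_poly (residue_map v) f) (x i).
  rewrite fE; apply/eqP; rewrite !hornerE rmorphM.
  rewrite -[x i ^+ d]mul1r -[X in X * _](rmorph1 (residue_map v)) -wu rmorphM.
  by rewrite -mulrA -mulrDr rS mulr0.
have f_simple : ~~ root (map_poly (residue_map v) f)^`() (x i).
  rewrite fE derivD derivC addr0 derivXn rootE hornerMn hornerXn.
  by rewrite -mulr_natl mulf_neq0 ?expf_neq0.
have [y yf yE] := hens f (x i) fm f_root f_simple.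
(* [Y] is an exact zero of the form lifting [x] on [A]; anisotropy forces [y] to vanish, although
   its residue [x i] does not. *)
pose Y j := if j == i then y else X j.
have : valring_val (Y i) = 0.
  apply: (an (fun j => valring_val (Y j))) (iA).
  rewrite -valring_val_form -[RHS](rmorph0 (val : valring v -> k)); congr val.
  have -> : \sum_(j in A) u j * Y j ^+ d = u i * y ^+ d + S.
    rewrite (bigD1 i) //= {1}/Y eqxx; congr (_ + _).
    by apply: eq_bigr => j /andP[_ /negbTE ji]; rewrite /Y ji.
  have -> : S = u i * (w * S) by rewrite mulrA [u i * w]mulrC wu mul1r.
  move: yf; rewrite -mulrDr rootE !hornerE => /eqP ->.
  by rewrite mulr0.
rewrite /Y eqxx => y0; have /eqP := xi; apply; rewrite -yE.
by rewrite -(rmorph0 (residue_map v)); congr (residue_map v _); exact: val_inj.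
Qed.

Lemma anisotropic_dim_descent (d n : nat) (t : k) :
    henselian v -> (0 < d)%N -> d%:R != 0 :> residue v ->
    t != 0 -> bijective (fun z : int => v t *~ z) ->
  anisotropic_dim k d n ->
  exists2 m, anisotropic_dim (residue v) d m & (n <= d * m)%N.
Proof.
move=> hens d0 dn0 t0 [h hK Kh] /anisotropic_dimP[a a0 an].
pose z i := h (v (a i)).
have zE i : v (a i) = v t *~ z i by rewrite /z Kh.
(* The whole power of [t] is removed, leaving a unit; the remainder of [z i] modulo [d] will select
   the block of [i]. *)
pose b i := a i * t ^ (- z i).
have b0 i : b i != 0 by rewrite mulf_neq0 ?expfz_neq0.
have vb i : v (b i) = 0.
  by rewrite Defs.valM ?expfz_neq0 // valXz // zE -mulrzDr subrr.
have bP i : b i \in valring_pred v by rewrite valringE vb lexx orbT.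
pose u i := Valring (bP i).
have dZ : 0 < d%:Z by [].
have cP i : (`|(z i %% d)%Z| < d)%N.
  by rewrite -ltz_nat gez0_abs ?ltz_pmod ?modz_ge0 ?gt_eqF.
pose c i := Ordinal (cP i).
have cE i : z i = (z i %/ d)%Z * d + (c i)%:Z.
  by rewrite {1}(divz_eq (z i) d) /= gez0_abs ?modz_ge0 ?gt_eqF.
pose A (j : 'I_d) : pred 'I_n := [pred i | c i == j].
have dimA j : anisotropic_dim (residue v) d #|A j|.
  have ru i : residue_map v (u i) != 0 by rewrite residue_map_neq0 /= b0 vb /=.
  apply: (@anisotropic_on_dim _ _ _ _ (fun i => residue_map v (u i))) => //.
  apply: henselian_anisotropic_residue => // x xE i ij.
  (* With [q] the quotient of [z i] by [d], scaling the variable by [t ^ (- q)] turns the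
     coefficient [a i] into [t ^+ j * b i]. So a zero of the unit form on block [j], extended by 0,
     becomes a zero of the full form. *)
  pose y i := if i \in A j then x i * t ^ (- (z i %/ d)%Z) else 0.
  have : y i = 0.
    apply: (an y) => //.
    transitivity (t ^+ j * \sum_(i in A j) b i * x i ^+ d); last first.
      by rewrite [X in _ * X]xE mulr0.
    rewrite mulr_sumr [RHS]big_mkcond; apply: eq_bigr => l _; rewrite /y.
    case: ifP => [/eqP lj|_]; last by rewrite expr0n -[d]prednK // mulr0.
    have tE : (t ^ (- (z l %/ d)%Z)) ^+ d = t ^+ j * t ^ (- z l).
      rewrite -[LHS]/(_ ^ d%:Z) exprz_exp -[t ^+ j]/(t ^ j%:Z) -expfzDr //.
      by rewrite [in RHS]cE lj opprD addrCA subrr addr0 mulNr.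
    by rewrite exprMn tE /b; ring.
  rewrite /y ij => /eqP; rewrite mulf_eq0 expfz_eq0 (negbTE t0) andbF orbF.
  by move/eqP.
(* Pigeonhole: the [d] blocks partition the variables, so [n] is at most [d] times the size of the
   largest. *)
have [j _ jmax] := @arg_maxnP _ (Ordinal d0) predT (fun j => #|A j|) isT.
exists #|A j| => //; rewrite -[n in (n <= _)%N]card_ord -sum1_card.
rewrite (partition_big c predT) //=.
under eq_bigr do rewrite sum1_card.
rewrite -[d in (_ <= d * _)%N]card_ord -sum_nat_const; apply: leq_sum => l _.
exact: jmax.
Qed.

End ValuedField.

Theorem theorem2 (R : realType) (d : nat) (k : fieldType)
    (G : orderedGroupType) (v : valuation k G)
    (d_ge1 : (1 <= d)%N)
    (v_discrete : discrete_group G)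
    (char_k : forall p : nat, p \in [pchar k] -> (d < p)%N)
    (char_res : forall p : nat, p \in [pchar (residue v)] -> ~~ (p %| d)%N) :
  (counting [set: mod_multiples G d] * u_diag (residue v) R d
     <= u_diag k R d)%E
  /\
  (henselian v ->
   u_diag k R d
     = (counting [set: mod_multiples G d] * u_diag (residue v) R d)%E).
Proof.
have [g g_bij] := discrete_group_generator v_discrete.
have [t t0 vt] := val_surj v g; rewrite -vt in g_bij.
have dR : 0 < d%:R :> R by rewrite ltr0n.
rewrite (counting_mod_multiples R d_ge1 g_bij).
have ge : (d%:R%:E * u_diag (residue v) R d <= u_diag k R d)%E.
  (* The positive real factor [d] passes inside the supremum, which treats finite and infinite
     values alike. *)
  rewrite -ereal_sup_pZl //; apply: ge_ereal_sup => _ [_ [n nP <-] <-].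
  apply: ereal_sup_ubound; exists (d * n)%N; last by rewrite natrM EFinM.
  exact: anisotropic_dim_lift g_bij nP.
split=> // hens; apply/eqP; rewrite eq_le ge andbT.
have dn0 : d%:R != 0 :> residue v.
  rewrite natf_neq0_pchar; apply/pnatP => // p _ pd.
  by apply/negP => /char_res; rewrite pd.
apply: ge_ereal_sup => _ [n nP <-].
have [m mP nm] := anisotropic_dim_descent hens d_ge1 dn0 t0 g_bij nP.
apply: (@le_trans _ _ (d%:R%:E * m%:R%:E)%E).
  by rewrite -EFinM lee_fin -natrM ler_nat.
by rewrite lee_pmul2l // ereal_sup_ubound //; exists m.
Qed.
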